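(* Let $H$ be a Hilbert space and $T$ a densely defined closed operator on $H$ with closed range. Then $T$ is normal (i.e. $TT^{*}=T^{*}T$) if and only if $w(T)$ is normal.
   Context: For a densely defined closed operator $A$ with closed range, $C(A)=D(A)\cap N(A)^{\perp}$, and the Moore–Penrose inverse $A^{\dagger}$ is defined on $R(A)\oplus^{\perp}R(A)^{\perp}$ by $A^{\dagger}y=(A|_{C(A)})^{-1}y$ for $y\in R(A)$ and $A^{\dagger}y=0$ for $y\in R(A)^{\perp}$. The generalized Cauchy dual is $w(A)=A(A^{*}A)^{\dagger}$ (products on natural domains). *)

(* Defs.v *)
(* (+ mathcomp-real-closed's complex numbers R[i] over a realType R). *)
From HB Require Import structures.
From mathcomp Require Import all_boot all_order all_algebra.
From mathcomp Require Import complex.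
From mathcomp Require Import reals.
From Stdlib Require Import ClassicalEpsilon.

Set Implicit Arguments.
Unset Strict Implicit.
Unset Printing Implicit Defensive.

Import Order.TTheory GRing.Theory Num.Theory.
Local Open Scope ring_scope.

Section Hilbert.
Variables (R : realType) (H : lmodType R[i]) (ip : H -> H -> R[i]).

(* [ip] is an inner product (linear in the first, conjugate-linear in the
   second argument) whose induced norm is complete: (H, ip) is a complex
   Hilbert space. Distances are measured via the squared norm ip z z. *)
Definition converges (u : nat -> H) (x : H) : Prop :=
  forall e : R[i], 0 < e ->
    exists N : nat, forall n, (N <= n)%N -> ip (u n - x) (u n - x) < e.

Definition cauchy (u : nat -> H) : Prop :=
  forall e : R[i], 0 < e ->
    exists N : nat, forall m n, (N <= m)%N -> (N <= n)%N ->
      ip (u m - u n) (u m - u n) < e.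

Definition is_hilbert : Prop :=
  [/\ (forall (a : R[i]) (x y z : H), ip (a *: x + y) z = a * ip x z + ip y z),
      (forall x y : H, ip y x = (ip x y)^*),
      (forall x : H, 0 <= ip x x),
      (forall x : H, ip x x = 0 -> x = 0)
    & (forall u : nat -> H, cauchy u -> exists x, converges u x)].

(* (Possibly unbounded) operators on H: a domain and an action on it. *)
Record op := Op { dom : H -> Prop; app : H -> H }.

Definition linear_op (T : op) : Prop :=
  [/\ dom T 0,
      (forall (a : R[i]) x y, dom T x -> dom T y -> dom T (a *: x + y))
    & (forall (a : R[i]) x y, dom T x -> dom T y ->
         app T (a *: x + y) = a *: app T x + app T y)].

Definition densely_defined (T : op) : Prop :=
  forall x : H, exists u : nat -> H, (forall n, dom T (u n)) /\ converges u x.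

Definition closed_op (T : op) : Prop :=
  forall (u : nat -> H) (x y : H), (forall n, dom T (u n)) ->
    converges u x -> converges (fun n => app T (u n)) y ->
    dom T x /\ app T x = y.

Definition range (T : op) (y : H) : Prop := exists x, dom T x /\ app T x = y.

Definition closed_set (P : H -> Prop) : Prop :=
  forall (u : nat -> H) (y : H), (forall n, P (u n)) -> converges u y -> P y.

Definition closed_range (T : op) : Prop := closed_set (range T).

Definition kernel (T : op) (x : H) : Prop := dom T x /\ app T x = 0.

Definition orth (P : H -> Prop) (y : H) : Prop := forall x, P x -> ip x y = 0.

(* C(A) = D(A) ∩ N(A)^⊥ *)
Definition coimage (T : op) (x : H) : Prop := dom T x /\ orth (kernel T) x.

Definition pick (P : H -> Prop) : H := epsilon (inhabits (0 : H)) P.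

(* Equality of operators: same domain, same action on it. *)
Definition op_eq (S T : op) : Prop :=
  (forall x, dom S x <-> dom T x) /\ (forall x, dom S x -> app S x = app T x).

(* Product on its natural domain: D(ST) = {x ∈ D(T) | Tx ∈ D(S)}. *)
Definition op_comp (S T : op) : op :=
  Op (fun x => dom T x /\ dom S (app T x)) (fun x => app S (app T x)).

(* Hilbert-space adjoint. *)
Definition adj_rel (T : op) (y z : H) : Prop :=
  forall x, dom T x -> ip (app T x) y = ip x z.

Definition adjoint (T : op) : op :=
  Op (fun y => exists z, adj_rel T y z) (fun y => pick (adj_rel T y)).

(* Moore–Penrose inverse: defined on R(A) ⊕ R(A)^⊥, with
   A† (y1 + y2) = (A|_{C(A)})^{-1} y1 for y1 ∈ R(A), y2 ∈ R(A)^⊥. *)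
Definition mp_rel (A : op) (y x : H) : Prop :=
  exists y1 y2, [/\ range A y1, orth (range A) y2, y = y1 + y2,
                    coimage A x & app A x = y1].

Definition mp_inv (A : op) : op :=
  Op (fun y => exists y1 y2, [/\ range A y1, orth (range A) y2 & y = y1 + y2])
     (fun y => pick (mp_rel A y)).

(* Generalized Cauchy dual w(A) = A (A^* A)^†. *)
Definition cauchy_dual (A : op) : op :=
  op_comp A (mp_inv (op_comp (adjoint A) A)).

(* Normality: T T^* = T^* T as operators. *)
Definition normal_op (T : op) : Prop :=
  op_eq (op_comp T (adjoint T)) (op_comp (adjoint T) T).

End Hilbert.

(* Main.v *)
(* Let P and Q be the orthogonal projections onto N(T)^perp and R(T), let V be
   the Moore-Penrose inverse of T, i.e. the operator with values in C(T) such
   that T V = Q, and let W be its adjoint. By the closed graph theorem V is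
   bounded, so W is everywhere defined, and T^* W = P. Hence T^* T V W = P,
   which makes w(T) equal to W; its adjoint is V, and w(T) is normal if and only
   if W V = V W.

   If T is normal, then N(T) is also the kernel of the adjoint, so P = Q, and
   W V y and V W y are both the preimage of P y under T^* T = T T^* orthogonal
   to N(T). Conversely, if W V = V W, comparing the kernels of both sides gives
   P = Q, and applying V W = W V to T^* T x or T T^* x recovers P x, from which
   the other product can be computed. *)

From mathcomp Require Import boolp classical_sets.
From mathcomp Require Import ring lra.
Require Import Defs.
From mathcomp Require Import all_boot all_order all_algebra.
From mathcomp Require Import complex reals.

Import Order.TTheory GRing.Theory Num.Theory.
Local Open Scope ring_scope.

(** * Hilbert space geometry *)

Section InnerProduct.
Variables (R : realType) (H : lmodType R[i]) (ip : H -> H -> R[i]).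
Hypothesis hilb : is_hilbert ip.
Implicit Types (x y z : H) (u v : nat -> H) (T S : op H).

Lemma ipDl x y z : ip (x + y) z = ip x z + ip y z.
Proof. by case: hilb => lin _ _ _ _; rewrite -[x in LHS]scale1r lin mul1r. Qed.

Lemma ip0l x : ip 0 x = 0.
Proof. by apply: (addrI (ip 0 x)); rewrite -ipDl !addr0. Qed.

Lemma ipZl a x y : ip (a *: x) y = a * ip x y.
Proof.
by case: hilb => lin _ _ _ _; rewrite -[a *: x]addr0 lin ip0l addr0.
Qed.

Lemma ipNl x y : ip (- x) y = - ip x y.
Proof. by rewrite -scaleN1r ipZl mulN1r. Qed.

Lemma ipBl x y z : ip (x - y) z = ip x z - ip y z.
Proof. by rewrite ipDl ipNl. Qed.

Lemma ipC x y : ip y x = (ip x y)^*.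
Proof. by case: hilb. Qed.

Lemma ipDr x y z : ip x (y + z) = ip x y + ip x z.
Proof. by rewrite ipC ipDl rmorphD /= -!ipC. Qed.

Lemma ip0r x : ip x 0 = 0.
Proof. by rewrite ipC ip0l conjC0. Qed.

Lemma ipZr a x y : ip x (a *: y) = a^* * ip x y.
Proof. by rewrite ipC ipZl rmorphM /= -ipC. Qed.

Lemma ipNr x y : ip x (- y) = - ip x y.
Proof. by rewrite ipC ipNl rmorphN /= -ipC. Qed.

Lemma ipBr x y z : ip x (y - z) = ip x y - ip x z.
Proof. by rewrite ipDr ipNr. Qed.

Lemma ip_ge0 x : 0 <= ip x x.
Proof. by case: hilb. Qed.

Lemma ip_eq0 x : ip x x = 0 -> x = 0.
Proof. by case: hilb => _ _ _ h _; exact: h. Qed.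

Lemma ip_inj x y : (forall z, ip z x = ip z y) -> x = y.
Proof.
by move=> h; apply: subr0_eq; apply: ip_eq0; rewrite ipBr h subrr.
Qed.

(** * Norm, Cauchy-Schwarz and the parallelogram law *)

Definition nrm x : R := Num.sqrt (complex.Re (ip x x)).

Lemma nrm_ge0 x : 0 <= nrm x.
Proof. exact: sqrtr_ge0. Qed.

Lemma ip_nrm x : ip x x = ((nrm x ^+ 2)%:C)%C.
Proof.
have := ip_ge0 x; rewrite /nrm lecE /=; case: (ip x x) => a b /= /andP[/eqP -> h].
by rewrite sqr_sqrtr.
Qed.

Lemma nrm_sq x : nrm x ^+ 2 = complex.Re (ip x x).
Proof. by rewrite ip_nrm. Qed.

Lemma nrm0_eq0 x : nrm x = 0 -> x = 0.
Proof. by move=> h; apply: ip_eq0; rewrite ip_nrm h expr0n. Qed.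

Lemma nrm0 : nrm 0 = 0.
Proof. by rewrite /nrm ip0l sqrtr0. Qed.

Lemma nrmN x : nrm (- x) = nrm x.
Proof. by rewrite /nrm ipNl ipNr opprK. Qed.

Lemma nrmBC x y : nrm (x - y) = nrm (y - x).
Proof. by rewrite -nrmN opprB. Qed.

Lemma nrmZ (t : R) x : 0 <= t -> nrm ((t%:C)%C *: x) = t * nrm x.
Proof.
move=> t0; rewrite /nrm ipZl ipZr ip_nrm [_^*](conjc_real t) -!rmorphM /=.
by rewrite mulrA -expr2 -exprMn !sqrtr_sqr !ger0_norm // ?mulr_ge0 ?nrm_ge0.
Qed.

Lemma cauchy_schwarz x y : `|ip x y| ^+ 2 <= ip x x * ip y y.
Proof.
have [->|y0] := eqVneq y 0; first by rewrite !ip0r normr0 expr0n mulr0.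
have yy : 0 < ip y y.
  by rewrite lt0r ip_ge0 andbT; apply/eqP => /ip_eq0; exact/eqP.
(* This is [ip y y] times the residual of [x] along [y], which avoids division; its squared norm is
   [ip y y] times the wanted difference. *)
have := ip_ge0 (ip y y *: x - ip x y *: y).
rewrite !(ipBl, ipBr, ipZl, ipZr) -!ipC (ipC x y).
rewrite [leRHS](_ : _ = ip y y * (ip x x * ip y y - `|ip x y| ^+ 2)).
  by rewrite pmulr_rge0 // subr_ge0.
by rewrite normCK; ring.
Qed.

Lemma Re_ip_le x y : complex.Re (ip x y) <= nrm x * nrm y.
Proof.
have := cauchy_schwarz x y; rewrite !ip_nrm -add_Re2_Im2 -rmorphM /= lecR => h.
apply: le_trans (ler_norm _) _.
rewrite -(@ler_pXn2r _ 2) ?nnegrE ?mulr_ge0 ?nrm_ge0 //.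
rewrite real_normK ?num_real // exprMn; apply: le_trans h.
by rewrite lerDl sqr_ge0.
Qed.

Lemma nrm_sqD x y : nrm (x + y) ^+ 2 =
  nrm x ^+ 2 + nrm y ^+ 2 + 2 * complex.Re (ip x y).
Proof.
rewrite !nrm_sq !(ipDl, ipDr) (ipC x y).
by case: (ip x y) (ip x x) (ip y y) => [a b] [c d] [e f] /=; ring.
Qed.

Lemma nrmD x y : nrm (x + y) <= nrm x + nrm y.
Proof.
rewrite -(@ler_pXn2r _ 2) ?nnegrE ?addr_ge0 ?nrm_ge0 // nrm_sqD.
have := Re_ip_le x y; lra.
Qed.

Lemma nrm_tri z x y : nrm (x - y) <= nrm (x - z) + nrm (z - y).
Proof. by rewrite -[x - y](subrKA z); exact: nrmD. Qed.

Lemma parallelogram x y :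
  nrm (x + y) ^+ 2 + nrm (x - y) ^+ 2 = 2 * nrm x ^+ 2 + 2 * nrm y ^+ 2.
Proof.
rewrite !nrm_sqD nrmN ipNr.
by case: (ip x y) => [a b] /=; ring.
Qed.

(** * Convergence and completeness in terms of the norm *)

Lemma small_inv (e : R) : 0 < e ->
  exists N, forall n, (N <= n)%N -> n.+1%:R^-1 < e.
Proof.
move=> e0; exists (Num.bound e^-1) => n Nn.
rewrite -[ltRHS]invrK ltf_pV2 ?posrE ?invr_gt0 ?ltr0n //.
apply: lt_trans (archi_boundP _) _; first by rewrite invr_ge0 ltW.
by rewrite ltr_nat ltnS.
Qed.

(** A positive [e : R[i]] has zero imaginary part, so the two kinds of tolerance correspond by
    squaring and taking square roots. *)
Lemma convergesP u x : converges ip u x <->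
  forall e : R, 0 < e -> exists N, forall n, (N <= n)%N -> nrm (u n - x) < e.
Proof.
split=> h e e0.
  have [|N hN] := h ((e ^+ 2)%:C)%C; first by rewrite ltcR exprn_gt0.
  exists N => n /hN; rewrite ip_nrm ltcR ltr_pXn2r ?nnegrE ?nrm_ge0 //.
  exact: ltW.
move: e0; rewrite ltcE /=; case: e => [a b] /= /andP[/eqP -> a0].
have [|N hN] := h (Num.sqrt a); first by rewrite sqrtr_gt0.
exists N => n /hN {}hN; rewrite ip_nrm ltcR -(sqr_sqrtr (ltW a0)).
by rewrite ltr_pXn2r ?nnegrE ?nrm_ge0 ?sqrtr_ge0.
Qed.

Lemma complete u :
  (forall e : R, 0 < e -> exists N, forall m n, (N <= n)%N -> (n <= m)%N ->
     nrm (u m - u n) < e) ->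
  exists x, converges ip u x.
Proof.
move=> h; case: hilb => _ _ _ _; apply => e.
rewrite ltcE /=; case: e => [a b] /= /andP[/eqP -> a0].
have [|N hN] := h (Num.sqrt a); first by rewrite sqrtr_gt0.
exists N => m n Nm Nn; rewrite ip_nrm ltcR -(sqr_sqrtr (ltW a0)).
rewrite ltr_pXn2r ?nnegrE ?nrm_ge0 ?sqrtr_ge0 //.
case/orP: (leq_total n m) => mn; first exact: hN.
by rewrite nrmBC; exact: hN.
Qed.

Lemma nrm_limit u x z (r : R) N : converges ip u x ->
  (forall n, (N <= n)%N -> nrm (u n - z) <= r) -> nrm (x - z) <= r.
Proof.
move=> /convergesP h b; apply/ler_addgt0Pr => e /h[M hM].
have := hM (maxn M N) (leq_maxl _ _); have := b (maxn M N) (leq_maxr _ _).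
have := nrm_tri (u (maxn M N)) x z; rewrite (nrmBC x (u _)); lra.
Qed.

(** * Closed subspaces, orthogonal projection and Riesz representation *)

Lemma converges_cst x : converges ip (fun=> x) x.
Proof. by move=> e e0; exists 0%N => n _; rewrite subrr ip0l. Qed.

Lemma closed_ip0 y : closed_set ip (fun x => ip x y = 0).
Proof.
move=> u x uy ux; apply/eqP; rewrite -normr_eq0 -sqrf_eq0.
have [->|y0] := eqVneq y 0; first by rewrite ip0r normr0 expr0n.
have yy : 0 < ip y y.
  by rewrite lt0r ip_ge0 andbT; apply/eqP => /ip_eq0; exact/eqP.
rewrite eq_le exprn_ge0 // andbT; apply/ler_addgt0Pr => e e0; rewrite add0r.
have [|N /(_ N (leqnn N)) hN] := ux (e / ip y y); first by rewrite divr_gt0.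
have <- : ip (x - u N) y = ip x y by rewrite ipBl uy subr0.
apply: le_trans (cauchy_schwarz _ _) _; rewrite -ler_pdivlMr //.
by rewrite -opprB ipNl ipNr opprK ltW.
Qed.

Lemma closed_orth (P : H -> Prop) : closed_set ip (orth ip P).
Proof.
move=> u y uP uy x Px; rewrite ipC; apply/eqP; rewrite conjC_eq0; apply/eqP.
by apply: (closed_ip0 x) uy => n; rewrite ipC (uP n x Px) conjC0.
Qed.

(** A sequence minimizing the distance from [x] to [M] is Cauchy; its limit is a nearest point, and
    minimality forces orthogonality. *)
Lemma projection (M : H -> Prop) x : M 0 ->
  (forall a y z, M y -> M z -> M (a *: y + z)) -> closed_set ip M ->
  exists m, M m /\ orth ip M (x - m).
Proof.
move=> M0 ML Mc.
pose E : set R := fun r => exists2 m, M m & r = nrm (x - m).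
have E0 : lbound E 0 by move=> _ [m _ ->]; exact: nrm_ge0.
have hE : has_inf E by split; [exists (nrm (x - 0)); exists 0 | exists 0].
set d := inf E.
have d0 : 0 <= d by apply: lb_le_inf => //; case: hE.
have dle m : M m -> d <= nrm (x - m).
  by move=> Mm; apply: ge_inf; [case: hE | exists m].
have /choice[u hu] (n : nat) : exists m, M m /\ nrm (x - m) < d + n.+1%:R^-1.
  have [|_ [m Mm ->] hm] := @inf_adherent _ E n.+1%:R^-1 _ hE; last by exists m.
  by rewrite invr_gt0 ltr0n.
(* The midpoint of [u m] and [u n] lies in [M], so with [e = 1/(n+1) <= 1] the parallelogram law
   gives the bound [4 (d + e)^2 - 4 d^2 = 8 d e + 4 e^2 <= (8 d + 4) e]. *)
have key m n : (n <= m)%N ->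
    nrm (u m - u n) ^+ 2 <= (8 * d + 4) * n.+1%:R^-1.
  move=> nm; have [Mm hm] := hu m; have [Mn hn] := hu n.
  have := parallelogram (x - u n) (x - u m).
  rewrite (_ : x - u n - (x - u m) = u m - u n); last first.
    by rewrite opprB addrC subrKA.
  have : 2 * d <= nrm (x - u n + (x - u m)).
    have Mmid := ML (2^-1%:C)%C _ _ (ML 1 _ _ Mn Mm) M0.
    have := dle _ Mmid.
    rewrite (_ : x - _ = ((2^-1 : R)%:C)%C *: (x - u n + (x - u m))).
      by rewrite nrmZ ?invr_ge0 //; lra.
    rewrite addr0 scale1r addrACA -opprD scalerBr; congr (_ - _).
    rewrite scalerDr -scalerDl -rmorphD /= (_ : 2^-1 + 2^-1 = 1 :> R) ?scale1r //.
    by lra.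
  have mn : m.+1%:R^-1 <= n.+1%:R^-1 :> R.
    by rewrite lef_pV2 ?posrE ?ltr0n // ler_nat.
  have n1 : n.+1%:R^-1 <= 1 :> R by rewrite invf_le1 ?ltr0n // ler1n.
  have n0 : 0 <= n.+1%:R^-1 :> R by rewrite invr_ge0 ler0n.
  move: hm hn (nrm_ge0 (x - u m)) (nrm_ge0 (x - u n)).
  move: (nrm (u m - u n)) (nrm (_ + _)) (nrm (x - u n)) (nrm (x - u m)) mn n1 n0.
  move: (n.+1%:R^-1) (m.+1%:R^-1) => e e' D S B A e'e e1 e0 hA hB A0 B0 hS eqS.
  have A2 : A ^+ 2 <= (d + e) ^+ 2 by rewrite ler_pXn2r ?nnegrE //; lra.
  have B2 : B ^+ 2 <= (d + e) ^+ 2 by rewrite ler_pXn2r ?nnegrE //; lra.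
  have S2 : (2 * d) ^+ 2 <= S ^+ 2 by rewrite ler_pXn2r ?nnegrE //; lra.
  have e2 : e * e <= e * 1 by rewrite ler_wpM2l.
  rewrite !expr2 in A2 B2 S2 eqS *; lra.
have [|m um] := complete u.
  move=> e e0; have d4 : 0 < 8 * d + 4 by lra.
  have [|N hN] := small_inv (e ^+ 2 / (8 * d + 4)).
    by rewrite divr_gt0 ?exprn_gt0.
  exists N => p q Nq qp; rewrite -(@ltr_pXn2r _ 2) ?nnegrE ?nrm_ge0 ?ltW //.
  apply: le_lt_trans (key _ _ qp) _.
  by rewrite mulrC -ltr_pdivlMr //; exact: hN.
have Mm : M m by apply: (Mc u) um => n; case: (hu n).
exists m; split=> // v Mv.
have xm : nrm (x - m) <= d.
  rewrite nrmBC; apply/ler_addgt0Pr => e /small_inv[N hN].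
  apply: (nrm_limit _ _ _ _ N um) => n /hN he; rewrite nrmBC.
  by have [_ /lt_trans xu] := hu n; rewrite ltW // xu // ltrD2l.
have [->|v0] := eqVneq v 0; first exact: ip0l.
have vv : ip v v != 0 by apply/eqP => /ip_eq0; exact/eqP.
have vvr : (ip v v)^* = ip v v by rewrite -ipC.
(* Removing the component [a *: v] lowers the squared norm of [e] by [|ip e v|^2 / ip v v], which
   minimality makes zero. *)
set e := x - m; set a := ip e v / ip v v.
have : ip e e <= ip (e - a *: v) (e - a *: v).
  rewrite !ip_nrm lecR ler_pXn2r ?nnegrE ?nrm_ge0 //.
  apply: le_trans xm _; rewrite /e -addrA -opprD (addrC m); apply: dle.
  exact: ML.
clearbody e; rewrite !(ipBl, ipBr, ipZl, ipZr) (ipC e v) /a.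
rewrite rmorphM /= fmorphV /= vvr.
rewrite [leRHS](_ : _ = ip e e - `|ip e v| ^+ 2 / ip v v); last first.
  by rewrite normCK; field.
rewrite lerDl oppr_ge0 pmulr_lle0 ?invr_gt0 ?lt0r ?vv ?ip_ge0 // => h.
have : `|ip e v| ^+ 2 == 0 by rewrite eq_le h exprn_ge0.
by rewrite sqrf_eq0 normr_eq0 => /eqP ->; rewrite conjC0.
Qed.

(** If [f] is not zero, some [e] orthogonal to its kernel has [f e != 0]; since
    [x - (f x / f e) *: e] lies in the kernel, a multiple of [e] represents [f]. *)
Lemma riesz (f : H -> R[i]) :
  (forall a x y, f (a *: x + y) = a * f x + f y) ->
  closed_set ip (fun x => f x = 0) -> exists y, forall x, f x = ip x y.
Proof.
move=> fL fc.
have f0 : f 0 = 0.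
  by apply: (addrI (f 0)); rewrite -[X in X + f 0]mul1r -fL scaler0 !addr0.
have [fz|/existsNP[x0 /eqP fx0]] := pselect (forall x, f x = 0).
  by exists 0 => x; rewrite fz ip0r.
have [|m [fm em]] := projection (fun x => f x = 0) x0 f0 _ fc.
  by move=> a y z fy fz; rewrite fL fy fz mulr0 addr0.
set e := x0 - m in em.
have fe : f e != 0 by rewrite /e addrC -scaleN1r fL fm mulr0 add0r.
have ee : ip e e != 0.
  by apply: contraNneq fe => /ip_eq0 ->; rewrite f0.
exists ((f e / ip e e)^* *: e) => x; rewrite ipZr conjCK.
have : ip (- (f x / f e) *: e + x) e = 0.
  by apply: em; rewrite fL; field.
rewrite ipDl ipZl mulNr addrC => /subr0_eq ->; field.
by rewrite fe ee.
Qed.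

(** * Baire category and the closed graph theorem *)

Lemma baire (A : nat -> H -> Prop) : (forall x, exists n, A n x) ->
  exists n a, exists2 r : R, 0 < r & forall x, nrm (x - a) <= r ->
    forall e : R, 0 < e -> exists2 y, A n y & nrm (x - y) < e.
Proof.
(* If no [A n] is dense in a ball, shrinking nested balls can be chosen that avoid each [A n] in
   turn; the limit of their centres then lies in no [A n]. *)
move=> cover; apply: contrapT => nA.
have step (n : nat) (c : H * R) : exists c' : H * R, 0 < c.2 ->
    [/\ 0 < c'.2, c'.2 <= n.+1%:R^-1, nrm (c'.1 - c.1) + c'.2 <= c.2
      & forall y, A n y -> c'.2 < nrm (c'.1 - y)].
  case: c => a r; have [r0|] := boolP (0 < r); last by exists (a, r).
  have [x [xa [e e0 hA]]] : exists x, nrm (x - a) <= r / 2 /\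
      exists2 e : R, 0 < e & forall y, A n y -> e <= nrm (x - y).
    apply: contrapT => nx; apply: nA; exists n, a, (r / 2); first by lra.
    move=> x xa e e0; apply: contrapT => ny; apply: nx; exists x; split=> //.
    by exists e => // y Ay; rewrite leNgt; apply/negP => xy; apply: ny; exists y.
  (* The three bounds keep the new ball away from [A n], inside the old ball, and of radius tending
     to zero. *)
  pose s : R := Num.min (e / 2) (Num.min (r / 2) n.+1%:R^-1).
  have n0 : 0 < n.+1%:R^-1 :> R by rewrite invr_gt0 ltr0n.
  have s0 : 0 < s by rewrite !lt_min n0 !divr_gt0.
  have [se sr sn] : [/\ s <= e / 2, s <= r / 2 & s <= n.+1%:R^-1].
    by rewrite !ge_min !lexx !orbT.
  exists (x, s) => _ /=; split=> // [|y /hA]; by lra.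
have /choice[F hF] : forall p : nat * (H * R), exists c' : H * R,
    0 < p.2.2 -> [/\ 0 < c'.2, c'.2 <= p.1.+1%:R^-1,
      nrm (c'.1 - p.2.1) + c'.2 <= p.2.2
      & forall y, A p.1 y -> c'.2 < nrm (c'.1 - y)] by case=> n c; exact: step.
pose c := fix c n := if n is k.+1 then F (k, c k) else (0, 1).
have c0 n : 0 < (c n).2.
  by elim: n => [|n IH] /=; [exact: ltr01 | have [] := hF (n, c n) IH].
have nest n k : nrm ((c (k + n)%N).1 - (c n).1) + (c (k + n)%N).2 <= (c n).2.
  elim: k => [|k IH]; first by rewrite subrr nrm0 add0r.
  have [_ _ h _] := hF ((k + n)%N, c (k + n)%N) (c0 _).
  have := nrm_tri (c (k + n)%N).1 (c (k.+1 + n)%N).1 (c n).1.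
  rewrite [c (k.+1 + n)%N]/= in h *; move: h => /=; lra.
have near n m : (n <= m)%N -> nrm ((c m).1 - (c n).1) <= (c n).2.
  by move=> /subnK <-; have := nest n (m - n)%N; have := c0 (m - n + n)%N; lra.
have [|b cb] := complete (fun n => (c n).1).
  (* The index shifts by one because ball [n.+1] is the one of radius at most [1/(n+1)]. *)
  move=> e /small_inv[N hN]; exists N.+1 => m [//|n] Nn nm.
  apply: le_lt_trans (near _ _ nm) _; apply: le_lt_trans (hN n Nn).
  by have [] := hF (n, c n) (c0 n).
have [n An] := cover b.
have [_ _ _ /(_ _ An)] := hF (n, c n) (c0 n).
rewrite ltNge => /negP; apply; rewrite nrmBC.
by apply: (nrm_limit _ _ _ _ n.+1 cb) => m /near.
Qed.
Lemma small_geom (c e : R) : 0 <= c -> 0 < e ->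
  exists N, forall n, (N <= n)%N -> c / 2 ^+ n < e.
Proof.
move=> c0 e0; have c1 : 0 < c + 1 by rewrite ltr_wpDl.
have [|N hN] := small_inv (e / (c + 1)); first by rewrite divr_gt0.
exists N => n /hN; rewrite ltr_pdivlMr // mulrC; apply: le_lt_trans.
rewrite ler_pM ?invr_ge0 ?exprn_ge0 ?lerDl //.
by rewrite lef_pV2 ?posrE ?ltr0n ?exprn_gt0 // -natrX ler_nat ltn_expl.
Qed.

Definition bounded_op (V : H -> H) : Prop :=
  exists C : R, forall x, nrm (V x) <= C * nrm x.

Lemma bounded_converges (V : H -> H) u x :
  (forall x y, V (x - y) = V x - V y) -> bounded_op V ->
  converges ip u x -> converges ip (fun n => V (u n)) (V x).
Proof.
move=> VB [C hC] /convergesP ux; apply/convergesP => e e0.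
have C0 : 0 < `|C| + 1 by rewrite ltr_wpDl.
have [|N hN] := ux (e / (`|C| + 1)); first by rewrite divr_gt0.
exists N => n /hN; rewrite ltr_pdivlMr // -VB mulrC; apply: le_lt_trans.
apply: le_trans (hC _) _; rewrite ler_wpM2r ?nrm_ge0 //.
by apply: le_trans (ler_norm C) _; rewrite lerDl.
Qed.

Lemma closed_graph (V : H -> H) :
  (forall a x y, V (a *: x + y) = a *: V x + V y) ->
  (forall u x w, converges ip u x -> converges ip (fun n => V (u n)) w ->
     V x = w) ->
  bounded_op V.
Proof.
move=> VL Vc.
have V0 : V 0 = 0.
  by apply: (addrI (V 0)); rewrite -[X in X + V 0]scale1r -VL scaler0 !addr0.
have VZ a x : V (a *: x) = a *: V x by rewrite -[a *: x]addr0 VL V0 addr0.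
have VB x y : V (x - y) = V x - V y by rewrite addrC -scaleN1r VL scaleN1r addrC.
(* The sublevel sets of [nrm (V x)] at natural numbers cover [H]. *)
have [|m0 [a [r r0 near_a]]] := baire (fun n x => nrm (V x) <= n%:R).
  move=> x; exists (Num.bound (nrm (V x))).
  by rewrite ltW // archi_boundP ?nrm_ge0.
(* Scaling the ball given by Baire: every [x] is approximated up to half a
   bound [s] of its norm by a [y] with [nrm (V y) <= K * s]. Iterating on
   [x - y] writes [x] as a series whose image under [V] converges. *)
pose K : R := 2 * m0%:R / r.
have K0 : 0 <= K by rewrite !mulr_ge0 // invr_ge0 ltW.
have halve x (s : R) : 0 < s -> nrm x <= s ->
    exists y, nrm (x - y) <= s / 2 /\ nrm (V y) <= K * s.
  move=> s0 xs; have t0 : 0 < r / s by rewrite divr_gt0.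
  (* Approximating both [a + (r/s) x] and [a] within [r / 4] leaves an error [r / 2] on the
     difference, hence [s / 2] after scaling by [s / r]. *)
  have r4 : 0 < r / 4 by lra.
  have [|y1 Vy1 hy1] := near_a (a + ((r / s)%:C)%C *: x) _ _ r4.
    by rewrite addrC addKr (nrmZ _ _ (ltW t0)) mulrAC ler_pdivrMr // ler_pM2l.
  have [|y0 Vy0 hy0] := near_a a _ _ r4; first by rewrite subrr nrm0 ltW.
  have sr0 : 0 <= s / r by rewrite divr_ge0 // ltW.
  exists (((s / r)%:C)%C *: (y1 - y0)); split.
    have -> : x - ((s / r)%:C)%C *: (y1 - y0) =
        ((s / r)%:C)%C *: (a + ((r / s)%:C)%C *: x - y1 - (a - y0)).
      have -> : a + ((r / s)%:C)%C *: x - y1 - (a - y0) =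
          ((r / s)%:C)%C *: x - (y1 - y0).
        by rewrite !opprB -(addrA a) [LHS]addrC subrKA addrCA.
      rewrite [RHS]scalerBr scalerA -rmorphM /= (_ : s / r * (r / s) = 1).
        by rewrite scale1r.
      by field; rewrite !gt_eqF.
    rewrite nrmZ //; apply: (@le_trans _ _ (s / r * (r / 2))).
      rewrite ler_wpM2l //.
      have := nrmD (a + ((r / s)%:C)%C *: x - y1) (- (a - y0)).
      by rewrite nrmN; lra.
    by rewrite mulrA divfK // gt_eqF.
  rewrite VZ nrmZ // (_ : K * s = s / r * (2 * m0%:R)); last by rewrite /K; ring.
  rewrite ler_wpM2l // VB; have := nrmD (V y1) (- V y0); rewrite nrmN; lra.
clearbody K.
have /choice[g hg] : forall p : H * R, exists y,
    0 < p.2 -> nrm p.1 <= p.2 -> nrm (p.1 - y) <= p.2 / 2 /\ nrm (V y) <= K * p.2.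
  move=> [x s]; have [s0|] := boolP (0 < s); last by exists 0.
  have [xs|] := boolP (nrm x <= s); last by exists 0.
  by have [y hy] := halve x s s0 xs; exists y.
exists (2 * K) => x; have [->|x0] := eqVneq x 0.
  by rewrite V0 nrm0 mulr0.
set s := nrm x.
have s0 : 0 < s.
  by rewrite lt_def nrm_ge0 andbT; apply: contraNneq x0 => /nrm0_eq0 ->.
pose sk n : R := s / 2 ^+ n.
have sk0 n : 0 < sk n by rewrite divr_gt0 ?exprn_gt0.
have skS n : sk n.+1 = sk n / 2 by rewrite /sk exprSr invfM mulrA.
(* [rest n] is the remainder of the series after [n] terms, so [x - rest n] is a partial sum. *)
pose rest := fix rest n := if n is k.+1 then rest k - g (rest k, sk k) else x.
have restle n : nrm (rest n) <= sk n.
  elim: n => [|n IH]; first by rewrite /sk expr0 divr1.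
  by rewrite skS; have [] := hg (rest n, sk n) (sk0 n) IH.
(* Since [K * sk n = 2 * K * (sk n - sk n.+1)], the bounds on the terms telescope. *)
have tail n k : nrm (V (x - rest (k + n)%N) - V (x - rest n)) <=
    2 * K * (sk n - sk (k + n)%N).
  elim: k => [|k IH]; first by rewrite !subrr nrm0 mulr0.
  have [_ /= hV] := hg (rest (k + n)%N, sk (k + n)%N) (sk0 _) (restle _).
  apply: le_trans (nrm_tri (V (x - rest (k + n)%N)) _ _) _.
  rewrite -VB [x - _ - _](_ : _ = g (rest (k + n)%N, sk (k + n)%N)); last first.
    by rewrite /= !opprB [LHS]addrC subrKA [LHS]addrC subrK.
  by rewrite addSn skS; lra.
have tail' n m : (n <= m)%N ->
    nrm (V (x - rest m) - V (x - rest n)) <= 2 * K * sk n.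
  move=> /subnK <-; apply: le_trans (tail _ _) _.
  by rewrite ler_wpM2l ?mulr_ge0 // gerBl ltW.
have [|w Vw] := complete (fun n => V (x - rest n)).
  move=> e e0; have [|N hN] := small_geom (2 * K * s) e _ e0.
    by rewrite !mulr_ge0 // ltW.
  exists N => p q Nq qp; apply: le_lt_trans (tail' _ _ qp) _.
  by rewrite /sk mulrA; exact: hN.
have -> : V x = w.
  apply: Vc Vw; apply/convergesP => e e0.
  have [|N hN] := small_geom s e _ e0; first exact: ltW.
  exists N => m Nm; rewrite addrC addKr nrmN.
  by apply: le_lt_trans (restle _) _; exact: hN.
rewrite -[w]subr0; apply: (nrm_limit _ _ _ _ 0 Vw) => m _.
by have := tail' 0%N m isT; rewrite /sk expr0 divr1 subrr V0.
Qed.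

(** Riesz representation applied to the continuous functional [ip (V x) y] of [x]. *)
Lemma bounded_adjoint (V : H -> H) :
  (forall a x y, V (a *: x + y) = a *: V x + V y) -> bounded_op V ->
  exists W : H -> H, forall x y, ip (V x) y = ip x (W y).
Proof.
move=> VL Vb.
have VB x y : V (x - y) = V x - V y by rewrite addrC -scaleN1r VL scaleN1r addrC.
have /choice[W hW] y : exists w, forall x, ip (V x) y = ip x w.
  apply: (riesz (fun x => ip (V x) y)) => [a x z|u x u0 ux].
    by rewrite VL ipDl ipZl.
  apply: (closed_ip0 y) (bounded_converges _ _ _ VB Vb ux) => n.
  exact: u0.
by exists W => x y; exact: hW.
Qed.

(** * Unbounded operators and the Moore-Penrose inverse *)

Lemma orth_linear (P : H -> Prop) a x y :
  orth ip P x -> orth ip P y -> orth ip P (a *: x + y).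
Proof.
by move=> xP yP z Pz; rewrite ipDr ipZr xP // yP // mulr0 addr0.
Qed.

Lemma op_eqP S T : op_eq S T <->
  forall x y, (dom S x /\ app S x = y) <-> (dom T x /\ app T x = y).
Proof.
split=> [[hd ha] x y|h]; first by split=> -[dx <-]; split; try exact/hd;
  rewrite ha //; exact/hd.
split=> [x|x Sx].
  by have [] := h x (app S x); have [] := h x (app T x); split; tauto.
by have /h[_ ->] : dom S x /\ app S x = app S x by [].
Qed.

(** * Adjoints and normality through graphs *)

Section DenselyDefined.
Variable T : op H.
Hypothesis Tdense : densely_defined ip T.

Lemma adj_rel_uniq y z z' : adj_rel ip T y z -> adj_rel ip T y z' -> z = z'.
Proof.
move=> hz hz'; apply: ip_inj => x; apply: subr0_eq; rewrite -ipBr.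
have [u [uT ux]] := Tdense x.
by apply: (closed_ip0 _ _ _ _ ux) => n; rewrite ipBr -hz ?hz' ?subrr.
Qed.

(** Density of the domain makes the adjoint vector unique, so the value taken by [pick] is the only
    candidate. *)
Lemma adjointP y z :
  (dom (adjoint ip T) y /\ app (adjoint ip T) y = z) <-> adj_rel ip T y z.
Proof.
have spec w : adj_rel ip T y w -> adj_rel ip T y (app (adjoint ip T) y).
  by move=> hw; apply: ClassicalEpsilon.epsilon_spec; exists w.
split=> [[[w hw] <-]|hz]; first exact: spec hw.
by split; [exists z | apply: adj_rel_uniq (spec _ hz) hz].
Qed.

Lemma comp_adjl x y :
  (dom (op_comp (adjoint ip T) T) x /\ app (op_comp (adjoint ip T) T) x = y) <->
  (dom T x /\ adj_rel ip T (app T x) y).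
Proof.
split=> [[[Tx dx] e]|[Tx /adjointP[dx e]]]; last by split.
by split=> //; apply/adjointP.
Qed.

Lemma comp_adjr x y :
  (dom (op_comp T (adjoint ip T)) x /\ app (op_comp T (adjoint ip T)) x = y) <->
  exists z, [/\ adj_rel ip T x z, dom T z & app T z = y].
Proof.
split=> [[[dx Tx] <-]|[z [/adjointP[dx <-] Tz e]]]; last by split.
by exists (app (adjoint ip T) x); split=> //; apply/adjointP.
Qed.

Lemma normalP : normal_op ip T <-> forall x y,
  (exists z, [/\ adj_rel ip T x z, dom T z & app T z = y]) <->
  (dom T x /\ adj_rel ip T (app T x) y).
Proof.
by split=> [/op_eqP h x y|h]; [rewrite -comp_adjl -comp_adjr
  | apply/op_eqP => x y; rewrite comp_adjl comp_adjr].
Qed.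

Lemma kernel_adj y : adj_rel ip T y 0 <-> orth ip (range T) y.
Proof.
split=> [h _ [x [Tx <-]]|h x Tx]; first by rewrite h // ip0r.
by rewrite ip0r; apply: h; exists x.
Qed.

End DenselyDefined.

(** * Projections and the Moore-Penrose inverse of a closed operator with closed range *)

Section MoorePenrose.
Variable T : op H.
Hypotheses (Tlin : linear_op T) (Tdense : densely_defined ip T).
Hypotheses (Tclosed : closed_op ip T) (Tran : closed_range ip T).

Lemma domB x y : dom T x -> dom T y -> dom T (x - y).
Proof.
case: Tlin => _ h _ Tx Ty; rewrite addrC -scaleN1r; exact: h.
Qed.

Lemma appB x y : dom T x -> dom T y -> app T (x - y) = app T x - app T y.
Proof.
by case: Tlin => _ _ h Tx Ty; rewrite addrC -scaleN1r h // scaleN1r addrC.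
Qed.

Lemma dom0 : dom T 0. Proof. by case: Tlin. Qed.

Lemma app0 : app T 0 = 0.
Proof. by have := appB _ _ dom0 dom0; rewrite !subrr. Qed.

Lemma orth_kernel_eq x y : orth ip (kernel T) x -> orth ip (kernel T) y ->
  kernel T (x - y) -> x = y.
Proof.
by move=> xN yN k; apply/subr0_eq/ip_eq0; rewrite ipBr xN // yN // subrr.
Qed.

Lemma coimage_inj x y : coimage ip T x -> coimage ip T y ->
  app T x = app T y -> x = y.
Proof.
move=> [Tx xN] [Ty yN] e; apply: orth_kernel_eq => //.
by split; [exact: domB | rewrite appB // e subrr].
Qed.

(** Closedness of [T] makes its kernel closed, so [projection] applies; [P x] is [x] minus its
    kernel component. *)
Lemma kernel_projection : exists P : H -> H, forall x,
  kernel T (x - P x) /\ orth ip (kernel T) (P x).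
Proof.
have [T0 Tcl Tal] := Tlin.
have /choice[P hP] x : exists y, kernel T (x - y) /\ orth ip (kernel T) y.
  have [| | |m [Nm hm]] := projection (kernel T) x.
  - by split; [exact: T0 | exact: app0].
  - move=> a y z [Ty y0] [Tz z0]; split; first exact: Tcl.
    by rewrite Tal // y0 z0 scaler0 addr0.
  - move=> u y uN uy; apply: (Tclosed u) => // [n|e e0]; first by case: (uN n).
    by exists 0%N => n _; case: (uN n) => _ ->; rewrite subrr ip0l.
  - by exists (x - m); rewrite subKr.
by exists P.
Qed.

Lemma range_projection : exists Q : H -> H, forall y,
  range T (Q y) /\ orth ip (range T) (y - Q y).
Proof.
have [T0 Tcl Tal] := Tlin.
have /choice[Q hQ] y : exists z, range T z /\ orth ip (range T) (y - z).
  apply: projection Tran; first by exists 0; split; [exact: T0 | exact: app0].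
  move=> a _ _ [x [Tx <-]] [z [Tz <-]].
  by exists (a *: x + z); split; [exact: Tcl | exact: Tal].
by exists Q.
Qed.

Lemma moore_penrose_inverse : exists P Q V : H -> H,
  [/\ forall x, kernel T (x - P x) /\ orth ip (kernel T) (P x),
      forall y, range T (Q y) /\ orth ip (range T) (y - Q y)
    & forall z, coimage ip T (V z) /\ app T (V z) = Q z].
Proof.
have [P hP] := kernel_projection; have [Q hQ] := range_projection.
have /choice[V hV] z : exists x, coimage ip T x /\ app T x = Q z.
  have [[x [Tx <-]] _] := hQ z; have [[Nx Tx0] xN] := hP x.
  have TP : dom T (P x) by rewrite -(subKr x (P x)); exact: domB.
  exists (P x); split=> //; apply/esym/subr0_eq; by rewrite -appB.
by exists P, Q, V.
Qed.

(* [P] and [Q] are the orthogonal projections onto [N(T)^\perp] and [R(T)], [V]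
   is the Moore-Penrose inverse of [T] and [W], introduced below, its adjoint. *)
Section Inverse.
Variables P Q V : H -> H.
Hypothesis hP : forall x, kernel T (x - P x) /\ orth ip (kernel T) (P x).
Hypothesis hQ : forall y, range T (Q y) /\ orth ip (range T) (y - Q y).
Hypothesis hV : forall z, coimage ip T (V z) /\ app T (V z) = Q z.

Lemma ip_Pl x y : ip (P x) y = ip (P x) (P y).
Proof.
have [hy _] := hP y; have [_ hx] := hP x.
by apply: subr0_eq; rewrite -ipBr ipC hx // conjC0.
Qed.

Lemma ip_PC x y : ip (P x) y = ip x (P y).
Proof. by rewrite ip_Pl ipC -ip_Pl -ipC. Qed.

Lemma ip_Ql x y : ip (Q x) y = ip (Q x) (Q y).
Proof.
have [_ hy] := hQ y; have [hx _] := hQ x.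
by apply: subr0_eq; rewrite -ipBr hy.
Qed.

Lemma ip_QC x y : ip (Q x) y = ip x (Q y).
Proof. by rewrite ip_Ql ipC -ip_Ql -ipC. Qed.

Lemma range_Q y : range T y -> Q y = y.
Proof.
move=> [x [Tx <-]]; apply/esym/subr0_eq; set y' := app T x.
have [[z [Tz e]] hy] := hQ y'; apply: ip_eq0; apply: hy.
by rewrite -e; exists (x - z); split; [exact: domB | rewrite appB].
Qed.

Lemma orth_P x : orth ip (kernel T) x -> P x = x.
Proof.
move=> xN; have [Nx PxN] := hP x; apply/esym/subr0_eq/ip_eq0.
by rewrite ipBr xN // PxN // subrr.
Qed.

Lemma V_eq x z : coimage ip T x -> app T x = Q z -> V z = x.
Proof.
by have [hz e] := hV z => hx ez; apply: coimage_inj => //; rewrite e.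
Qed.

Lemma V_app x : dom T x -> V (app T x) = P x.
Proof.
move=> Tx; have [[TxP x0] PxN] := hP x.
have TP : dom T (P x) by rewrite -(subKr x (P x)); exact: domB.
apply: V_eq => //; rewrite range_Q; last by exists x.
by apply/esym/subr0_eq; rewrite -appB.
Qed.

Lemma V_linear a x y : V (a *: x + y) = a *: V x + V y.
Proof.
have [T0 Tcl Tal] := Tlin.
have [[Tx xN] ex] := hV x; have [[Ty yN] ey] := hV y.
apply: V_eq; first by split; [exact: Tcl | exact: orth_linear].
rewrite Tal // ex ey; apply: ip_inj => z.
by rewrite -ip_QC !(ipDr, ipZr) -!ip_QC.
Qed.

(** If [u] tends to [x] and [V u] to [w], then [T V u = Q u] tends to [Q x]; as [T] and the
    orthogonal complement of its kernel are closed, [w] is the preimage of [Q x] in the coimage. *)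
Lemma V_bounded : bounded_op V.
Proof.
apply: closed_graph V_linear _ => u x w ux Vu.
have Q_bounded : bounded_op Q.
  exists 1 => y; rewrite mul1r.
  have := nrm_sqD (Q y) (y - Q y); rewrite addrC subrK.
  have [Ry /(_ _ Ry) ->] := hQ y; rewrite mulr0 addr0 => e.
  by rewrite -(@ler_pXn2r _ 2) ?nnegrE ?nrm_ge0 // e lerDl sqr_ge0.
have QB y z : Q (y - z) = Q y - Q z.
  by apply: ip_inj => t; rewrite -ip_QC !ipBr -!ip_QC.
have [|Tw ew] := Tclosed _ _ (Q x) (fun n => proj1 (proj1 (hV (u n)))) Vu.
  rewrite (_ : (fun n => _) = (fun n => Q (u n))).
    exact: bounded_converges.
  by apply: funext => n; case: (hV (u n)).
apply: V_eq => //; split=> //.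
by apply: (closed_orth _ _ _ _ Vu) => n; case: (hV (u n)) => [[]].
Qed.

(** * The adjoint [W] of the Moore-Penrose inverse *)

Variable W : H -> H.
Hypothesis hW : forall x y, ip (V x) y = ip x (W y).

Lemma W_V x y : ip (W x) y = ip x (V y).
Proof. by rewrite ipC -hW -ipC. Qed.

(** The adjoint form of [V T = P] on the domain of [T]. *)
Lemma adj_rel_W y : adj_rel ip T (W y) (P y).
Proof. by move=> x Tx; rewrite -hW V_app // ip_PC. Qed.

(** The adjoint form of [T V = Q]. *)
Lemma W_adj_rel y z : adj_rel ip T y z -> W z = Q y.
Proof.
move=> h; apply: ip_inj => x; have [[TV _] e] := hV x.
by rewrite -hW -h // e ip_QC.
Qed.

(** Taking adjoints in [V Q = V] gives [Q W = W], and [T V = Q]. *)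
Lemma app_V_W y : app T (V (W y)) = W y.
Proof.
have [_ ->] := hV (W y); apply: ip_inj => x; rewrite -ip_QC -!hW.
congr (ip _ y); have [[TV VN] e] := hV x; apply: V_eq => //.
by rewrite e [RHS]range_Q //; case: (hQ x).
Qed.

Lemma P_V z : P (V z) = V z.
Proof. by apply: orth_P; case: (hV z) => [[]]. Qed.

(** * Identification of the generalized Cauchy dual with [W] *)

Let TsT := op_comp (adjoint ip T) T.

Lemma range_TsT_P y : dom TsT (V (W y)) /\ app TsT (V (W y)) = P y.
Proof.
apply/comp_adjl => //; split; first by case: (hV (W y)) => [[]].
by rewrite app_V_W; exact: adj_rel_W.
Qed.

Lemma kernel_TsT x : dom TsT x -> app TsT x = 0 -> kernel T x.
Proof.
move=> dx e; have [|Tx h] := (comp_adjl T Tdense x 0).1; first by split.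
by split=> //; apply: ip_eq0; rewrite h // ip0r.
Qed.

Lemma cauchy_dualE y :
  dom (cauchy_dual ip T) y /\ app (cauchy_dual ip T) y = W y.
Proof.
have orth_ker z : orth ip (range TsT) (z - P z).
  have [[Tk k0] _] := hP z.
  move=> r [x /comp_adjl[//|Tx hr]].
  by rewrite ipC -hr // k0 ip0l conjC0.
have dec : [/\ range TsT (P y), orth ip (range TsT) (y - P y)
    & y = P y + (y - P y)].
  by split; [exists (V (W y)); exact: range_TsT_P | | rewrite addrC subrK].
(* Any candidate for [pick] has the same image under [T]: [W y1 = W T^* T x = Q T x = T x], while
   [W y2 = 0] because the values of [V] lie in the range of [TsT]. *)
have mp_W x : mp_rel ip TsT y x -> dom T x /\ app T x = W y.
  move=> [y1 [y2 [_ hy2 ey [dx _] ex]]].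
  have [|Tx h] := (comp_adjl T Tdense x y1).1; first by split.
  have Wy2 : W y2 = 0.
    apply: ip_inj => z; rewrite -hW ip0r -P_V; apply: hy2.
    by exists (V (W (V z))); exact: range_TsT_P.
  have -> : W y = W y1 + W y2 by apply: ip_inj => z; rewrite ipDr -!hW ey ipDr.
  by rewrite Wy2 addr0 (W_adj_rel _ _ h) range_Q //; exists x.
have [|Tx ex] := mp_W (app (mp_inv ip TsT) y).
  apply: ClassicalEpsilon.epsilon_spec; exists (V (W y)), (P y), (y - P y).
  have [r1 r2 r3] := dec; have [d e] := range_TsT_P y; split=> //; split=> //.
  move=> k [dk k0]; have [[_ h] _] := hV (W y).
  by apply: h; exact: kernel_TsT.
by split=> //; split=> //; exists (P y), (y - P y).
Qed.

(** The dual is the everywhere defined [W] and its adjoint is [V], so both products are total and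
    only their values matter. *)
Lemma cauchy_dual_normalP :
  normal_op ip (cauchy_dual ip T) <-> forall x, W (V x) = V (W x).
Proof.
have cd_dense : densely_defined ip (cauchy_dual ip T).
  move=> x; exists (fun=> x); split; last exact: converges_cst.
  by move=> _; case: (cauchy_dualE x).
have cd_adj x y : adj_rel ip (cauchy_dual ip T) x y <-> y = V x.
  split=> [h|-> z _]; last by case: (cauchy_dualE z) => _ ->; exact: W_V.
  apply: ip_inj => z; have [dz e] := cauchy_dualE z.
  by rewrite -h // e W_V.
split=> [/(normalP _ cd_dense) h x|h].
  have [_ eV] := cauchy_dualE (V x); have [_ eW] := cauchy_dualE x.
  have [|_ /cd_adj ->] := (h x (W (V x))).1; last by rewrite eW.
  by exists (V x); split; [exact/cd_adj | case: (cauchy_dualE (V x)) | ].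
apply/(normalP _ cd_dense) => x y.
have [dV eV] := cauchy_dualE (V x); have [dx eW] := cauchy_dualE x.
rewrite eW; split=> [[z [/cd_adj -> _ <-]]|[_ /cd_adj ->]].
  by split=> //; apply/cd_adj; rewrite eV h.
by exists (V x); split=> //; [exact/cd_adj | rewrite eV h].
Qed.

(** * Normality of [T] and commutation of [V] with [W] *)

Lemma P_eq0 x : P x = 0 <-> kernel T x.
Proof.
have [k h] := hP x; split=> [e|Nx]; first by rewrite e subr0 in k.
by apply: ip_eq0; rewrite -ip_Pl ipC h // conjC0.
Qed.

Lemma Q_eq0 y : Q y = 0 <-> adj_rel ip T y 0.
Proof.
have [r h] := hQ y; split=> [e|/kernel_adj h0].
  by apply/kernel_adj; rewrite e subr0 in h.
by apply: ip_eq0; rewrite -ip_Ql; exact: h0.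
Qed.

Lemma adj_relP x y : adj_rel ip T x y -> P y = y.
Proof.
by move=> h; apply: orth_P => k [Tk k0]; rewrite -h // k0 ip0l.
Qed.

(** Both projections of [x] are orthogonal to the common kernel, and they differ by an element of
    it. *)
Lemma projections_eq : (forall x, kernel T x <-> adj_rel ip T x 0) ->
  forall x, P x = Q x.
Proof.
move=> N x; have [kP hPx] := hP x; have [rQ hQx] := hQ x.
have kQ : kernel T (x - Q x) by apply/N/kernel_adj.
have oQ : orth ip (kernel T) (Q x).
  by move=> k /N/kernel_adj hk; rewrite ipC hk // conjC0.
apply: orth_kernel_eq => //; have [[Ta a0] [Tb b0]] := (kQ, kP).
have -> : P x - Q x = (x - Q x) - (x - P x) by rewrite opprB [RHS]addrC subrKA.
by split; [exact: domB | rewrite appB // a0 b0 subrr].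
Qed.

Lemma kernel_adj_rel0 x : kernel T x <-> dom T x /\ adj_rel ip T (app T x) 0.
Proof.
split=> [[Tx x0]|[Tx h]]; first by split=> // z _; rewrite x0 !ip0r.
by split=> //; apply: ip_eq0; rewrite h // ip0r.
Qed.

Lemma normal_commute : normal_op ip T -> forall x, W (V x) = V (W x).
Proof.
move=> /(normalP _ Tdense) norm.
(* The kernel of [T] is that of [T^* T], and the kernel of [T^*] is that of [T T^*]. *)
have N x : kernel T x <-> adj_rel ip T x 0.
  rewrite kernel_adj_rel0 -norm; split=> [[z [hz Tz z0]]|h].
    suff z0' : z = 0 by rewrite z0' in hz.
    by apply: ip_eq0; rewrite -hz // z0 ip0l.
  by exists 0; split=> //; [exact: dom0 | exact: app0].
have PQ := projections_eq N.
move=> y; have [[Ta aN] _] := hV (W y); have [[Tv _] ev] := hV y.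
(* [T T^* W V y = T P V y = T V y = Q y], and normality turns this into [T^* T W V y = Q y]. *)
have [|Tb hb] := (norm (W (V y)) (Q y)).1.
  exists (V y); split=> //; rewrite -[X in adj_rel _ _ _ X]P_V.
  exact: adj_rel_W.
have bN : orth ip (kernel T) (W (V y)).
  have [] := hP (W (V y)); rewrite PQ range_Q // -app_V_W.
  by exists (V (W (V y))); split=> //; case: (hV (W (V y))) => [[]].
apply/esym/orth_kernel_eq => //; apply/kernel_adj_rel0; split; first exact: domB.
move=> x Tx; rewrite appB // ipBr hb // app_V_W adj_rel_W // PQ subrr.
by rewrite ip0r.
Qed.

Lemma V_eq0 x : V x = 0 <-> Q x = 0.
Proof.
have [_ e] := hV x; split=> [x0|Qx0]; first by rewrite -e x0 app0.
apply: V_eq; last by rewrite Qx0 app0.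
by split=> [|k _]; [exact: dom0 | rewrite ip0r].
Qed.

Lemma W_eq0 y : W y = 0 <-> P y = 0.
Proof.
split=> [y0|Py0]; last first.
  by apply: ip_inj => x; rewrite -hW -P_V ip_PC Py0 !ip0r.
apply: (adj_rel_uniq _ Tdense 0); first by rewrite -y0; exact: adj_rel_W.
by move=> x _; rewrite !ip0r.
Qed.

Lemma commute_normal : (forall x, W (V x) = V (W x)) -> normal_op ip T.
Proof.
move=> comm; apply/(normalP _ Tdense).
have V0 : V 0 = 0 by apply/V_eq0/Q_eq0 => x _; rewrite !ip0r.
have W0 : W 0 = 0.
  by apply/W_eq0/P_eq0; split; [exact: dom0 | exact: app0].
(* The kernels of [W] and [V] are those of [P] and [Q]. They coincide: [W V x = 0] forces
   [V x = P V x = 0], and [V W x = 0] forces [W x = T V W x = 0]. *)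
have PQ : forall x, P x = Q x.
  apply: projections_eq => x; rewrite -P_eq0 -Q_eq0 -W_eq0 -V_eq0; split=> [Wx|Vx].
    by rewrite -P_V; apply/W_eq0; rewrite comm Wx.
  by rewrite -app_V_W -comm Vx W0 app0.
move=> x y; split=> [[z [hz Tz ey]]|[Tx hy]].
  (* [V W y = W V T z = W P z = W z = Q x = P x]; hence [x] is in the domain and
     [T x = T P x = W y]. *)
  have ez : V (W y) = P x.
    by rewrite -comm -ey V_app // (adj_relP _ _ hz) (W_adj_rel _ _ hz) PQ.
  have [[TP _] _] := hV (W y); rewrite ez in TP.
  have [[Tk k0] _] := hP x.
  have Tx : dom T x.
    have := domB _ _ Tk (domB _ _ dom0 TP); rewrite sub0r opprK subrK //.
  split=> //; have := appB _ _ Tx TP; rewrite k0 => /esym/subr0_eq ->.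
  rewrite -ez app_V_W -[X in adj_rel ip T _ X](_ : P y = y).
    exact: adj_rel_W.
  by rewrite PQ range_Q //; exists z.
have oQ : adj_rel ip T (x - Q x) 0 by apply/kernel_adj; case: (hQ x).
(* [W V y = V W y = V Q T x = P x = Q x], so [T^* Q x = P V y = V y]; adding [x - Q x], which [T^*]
   kills, gives [T^* x = V y]. *)
have Qx : adj_rel ip T (Q x) (V y).
  suff -> : Q x = W (V y) by rewrite -[X in adj_rel _ _ _ X]P_V; exact: adj_rel_W.
  rewrite comm (W_adj_rel _ _ hy) -PQ -V_app //.
  by rewrite range_Q //; exists x.
have [[Tv _] ev] := hV y; exists (V y); split=> //.
  by move=> k Tk; rewrite -[x in LHS](subrK (Q x)) ipDr oQ // Qx // ip0r add0r.
by rewrite ev -PQ (adj_relP _ _ hy).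
Qed.

End Inverse.

Lemma normal_cauchy_dual : normal_op ip T <-> normal_op ip (cauchy_dual ip T).
Proof.
have [P [Q [V [hP hQ hV]]]] := moore_penrose_inverse.
have [| |W hW] := bounded_adjoint V.
- exact: V_linear hQ hV.
- exact: V_bounded hQ hV.
split=> [N|N].
  by apply/(cauchy_dual_normalP P Q V hP hQ hV W hW); exact: normal_commute.
apply: commute_normal => //.
by apply/(cauchy_dual_normalP P Q V hP hQ hV W hW).
Qed.

End MoorePenrose.

End InnerProduct.

Theorem theorem2p4 (R : realType) (H : lmodType R[i]) (ip : H -> H -> R[i])
  (T : op H) :
  is_hilbert ip ->
  linear_op T -> densely_defined ip T -> closed_op ip T -> closed_range ip T ->
  (normal_op ip T <-> normal_op ip (cauchy_dual ip T)).
Proof.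
by move=> *; exact: normal_cauchy_dual.
Qed.
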